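(* Let $\mathbb{F}$ be a field and $G$ a group. The rule $$\mathrm{Gr}(G,\mathbb{F})\times\mathrm{Gr}(G,\mathbb{F})\to\mathrm{Gr}(G,\mathbb{F}),\qquad([A_G],[A'_G])\mapsto[A_G\otimes^G_{\mathbb{F}}A'_G]$$ determines a well-defined operation which turns $\mathrm{Gr}(G,\mathbb{F})$ into an abelian monoid, whose identity is the graded class $[\mathbb{F}G]$ of the ordinary group algebra.
   Context: Algebras are associative and unital. A $G$-graded $\mathbb{F}$-algebra is an $\mathbb{F}$-algebra with a vector space decomposition $A_G=\bigoplus_{g\in G}A_g$ with $A_gA_h\subseteq A_{gh}$. A graded isomorphism is a degree-preserving algebra isomorphism. $\mathrm{Gr}(G,\mathbb{F})=\mathrm{Gr}_{\kappa}(G,\mathbb{F})$ is the set of graded-isomorphism classes $[A_G]$ of $G$-graded $\mathbb{F}$-algebras whose cardinality is bounded by some infinite cardinality $\kappa$. The graded product is the subalgebra $A_G\otimes^G_{\mathbb{F}}A'_G=\bigoplus_{g\in G}A_g\otimes_{\mathbb{F}}A'_g$ of $A_G\otimes_{\mathbb{F}}A'_G$, with $g$-component $A_g\otimes_{\mathbb{F}}A'_g$. $\mathbb{F}G$ carries its natural $G$-grading with components $\mathbb{F}g$. *)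

(* Defs.v *)
From HB Require Import structures.
From mathcomp Require Import all_boot all_order all_algebra.
From mathcomp Require Import finmap monalg.
From mathcomp Require Import boolp classical_sets functions cardinality.
Set Implicit Arguments.
Unset Strict Implicit.
Unset Printing Implicit Defensive.
Import GRing.Theory.
Local Open Scope ring_scope.
Local Open Scope quotient_scope.

(* Associative unital algebras.  The library's algType requires 1 != 0; the   *)
(* zero algebra is allowed here.                                              *)

Record algebra (F : fieldType) := Algebra {
  alg_lmod : lmodType F;
  alg_one : alg_lmod;
  alg_mul : alg_lmod -> alg_lmod -> alg_lmod;
  _ : associative alg_mul;
  _ : left_id alg_one alg_mul;
  _ : right_id alg_one alg_mul;
  _ : forall y, linear (alg_mul^~ y);
  _ : forall x, linear (alg_mul x)
}.

Definition alg_sort (F : fieldType) (A : algebra F) : Type := alg_lmod A.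
Coercion alg_sort : algebra >-> Sortclass.

HB.instance Definition _ (F : fieldType) (A : algebra F) :=
  GRing.Lmodule.copy (alg_sort A) (alg_lmod A).

Section AlgebraRing.
Variables (F : fieldType) (A : algebra F).
Let mul : A -> A -> A := @alg_mul F A.

Fact alg_mulA : associative mul.
Proof. by rewrite /mul; case: A. Qed.
Fact alg_mul1x : left_id (alg_one A : A) mul.
Proof. by rewrite /mul; case: A. Qed.
Fact alg_mulx1 : right_id (alg_one A : A) mul.
Proof. by rewrite /mul; case: A. Qed.
Fact alg_mul_linl y : linear (mul^~ y).
Proof. by rewrite /mul; case: A y. Qed.
Fact alg_mul_linr x : linear (mul x).
Proof. by rewrite /mul; case: A x. Qed.
Fact alg_mulDl : left_distributive mul +%R.
Proof. by move=> x y z; have := alg_mul_linl z 1 x y; rewrite !scale1r. Qed.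
Fact alg_mulDr : right_distributive mul +%R.
Proof. by move=> z x y; have := alg_mul_linr z 1 x y; rewrite !scale1r. Qed.

HB.instance Definition _ := GRing.Zmodule_isPzRing.Build (alg_sort A)
  alg_mulA alg_mul1x alg_mulx1 alg_mulDl alg_mulDr.

Lemma algMlinl (y : A) : linear (fun x : A => x * y).
Proof. exact: alg_mul_linl. Qed.
Lemma algMlinr (x : A) : linear (fun y : A => x * y).
Proof. exact: alg_mul_linr. Qed.
End AlgebraRing.

Section LinearFacts.
Variables (F : fieldType) (V W : lmodType F).

Lemma lin0 (f : V -> W) : linear f -> f 0 = 0.
Proof. by move=> lf; have := lf (-1) 0 0; rewrite scaler0 addr0 scaleN1r addNr. Qed.

Lemma linD (f : V -> W) : linear f -> {morph f : x y / x + y}.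
Proof. by move=> lf x y; have := lf 1 x y; rewrite !scale1r. Qed.

Lemma linZ (f : V -> W) : linear f -> forall a x, f (a *: x) = a *: f x.
Proof. by move=> lf a x; have := lf a x 0; rewrite !addr0 lin0 ?addr0. Qed.

Lemma lin_sum (f : V -> W) (I : Type) (r : seq I) (P : pred I) (E : I -> V) :
  linear f -> f (\sum_(i <- r | P i) E i) = \sum_(i <- r | P i) f (E i).
Proof. by move=> lf; apply: (big_morph f (linD lf) (lin0 lf)). Qed.

Lemma lin_ker_closed (f g : V -> W) :
  linear f -> linear g -> submod_closed [pred x | f x == g x].
Proof.
move=> lf lg; split=> [|a u v]; rewrite !inE; first by rewrite !lin0.
by move=> /eqP fu /eqP fv; rewrite lf lg fu fv.
Qed.
End LinearFacts.

(* Linear span of a set of vectors, as the smallest subspace containing it.   *)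

Definition span (F : fieldType) (V : lmodType F) (S : V -> Prop) : {pred V} :=
  [pred x | `[< forall P : {pred V}, submod_closed P ->
                  (forall s, S s -> s \in P) -> x \in P >]].

Section SpanFacts.
Variables (F : fieldType) (V : lmodType F) (S : V -> Prop).

Lemma spanP x : reflect
  (forall P : {pred V}, submod_closed P -> (forall s, S s -> s \in P) -> x \in P)
  (x \in span S).
Proof. exact: asboolP. Qed.

Lemma span_closed : submod_closed (span S).
Proof.
split=> [|a u v]; first by apply/spanP => P [].
move=> /spanP hu /spanP hv; apply/spanP => P cP SP.
by apply: cP.2; [apply: hu|apply: hv].
Qed.

Lemma mem_span s : S s -> s \in span S.
Proof. by move=> Ss; apply/spanP => P _; apply. Qed.

Lemma span_sub (P : {pred V}) : submod_closed P -> (forall s, S s -> s \in P) ->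
  {subset span S <= P}.
Proof. by move=> cP SP x /spanP; apply. Qed.

HB.instance Definition _ := GRing.isSubmodClosed.Build F V (span S) span_closed.
End SpanFacts.

Lemma closed_sum (F : fieldType) (V : lmodType F) (P : {pred V}) (I : eqType)
  (r : seq I) (Q : pred I) (E : I -> V) : submod_closed P ->
  (forall i, i \in r -> Q i -> E i \in P) -> \sum_(i <- r | Q i) E i \in P.
Proof.
move=> [P0 cP] h; rewrite big_seq_cond.
by elim/big_ind: _ => // [x y Px Py|i /andP[]]; [rewrite -[x]scale1r; exact: cP|exact: h].
Qed.

(* Linear extension of a map defined on the basis of a free module.           *)

Definition mlift (F : fieldType) (K : choiceType) (W : lmodType F) (f : K -> W)
  (m : {malg F[K]}) : W := \sum_(k <- msupp m) m@_k *: f k.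

Section FreeModule.
Variables (F : fieldType) (K : choiceType) (W : lmodType F) (f : K -> W).

Lemma mliftEw (m : {malg F[K]}) (d : {fset K}) : fsubset (msupp m) d ->
  mlift f m = \sum_(k <- d) m@_k *: f k.
Proof.
by move=> le; apply: big_fset_incl le _ => k _ /mcoeff_outdom ->; rewrite scale0r.
Qed.

Lemma mlift_linear : linear (mlift f).
Proof.
move=> a m n; pose d := fsetU (msupp m) (msupp n).
have sm : fsubset (msupp m) d by apply: fsubsetUl.
have sn : fsubset (msupp n) d by apply: fsubsetUr.
have sa : fsubset (msupp (a *: m + n)) d.
  apply: fsubset_trans (msuppD_le _ _) _; apply: fsetUSS => //.
  exact: msuppZ_le.
rewrite (mliftEw sm) (mliftEw sn) (mliftEw sa) scaler_sumr -big_split /=.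
by apply: eq_bigr => k _; rewrite mcoeffD mcoeffZ scalerDl scalerA.
Qed.

Lemma mliftU k : mlift f << k >> = f k.
Proof.
rewrite (@mliftEw _ [fset k]%fset) ?msuppU_le // big_seq_fset1.
by rewrite mcoeffUU scale1r.
Qed.

Lemma malg_lin (m : {malg F[K]}) : m = \sum_(k <- msupp m) m@_k *: << k >>.
Proof.
rewrite {1}[m]monalgE; apply: eq_bigr => k _.
by apply/malgP => k'; rewrite mcoeffZ !mcoeffU mulr_natr.
Qed.

Lemma malg_ext (g h : {malg F[K]} -> W) : linear g -> linear h ->
  (forall k, g << k >> = h << k >>) -> g =1 h.
Proof.
move=> lg lh e m; rewrite [m]malg_lin !lin_sum //.
by apply: eq_bigr => k _; rewrite (linZ lg) (linZ lh) e.
Qed.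
End FreeModule.

(* Tensor product over F: the quotient of the free vector space on U * V by   *)
(* the subspace generated by the bilinearity relations.                       *)

Variant tensor_rel (F : fieldType) (U V : lmodType F) : {malg F[(U * V)%type]} -> Prop :=
| TensorRelL a u u' v :
    tensor_rel (<< (a *: u + u', v) >> - (a *: << (u, v) >> + << (u', v) >>))
| TensorRelR a u v v' :
    tensor_rel (<< (u, a *: v + v') >> - (a *: << (u, v) >> + << (u, v') >>)).

Definition tensor (F : fieldType) (U V : lmodType F) : Type :=
  Quotient.quot (span (@tensor_rel F U V)).

Section Tensor.
Variables (F : fieldType) (U V : lmodType F).
Local Notation N := (span (@tensor_rel F U V)).
Local Notation T := (tensor U V).

HB.instance Definition _ := GRing.Zmodule.copy T (Quotient.quot N).

Definition tensor_pi (m : {malg F[(U * V)%type]}) : T := \pi_(Quotient.quot N) m.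

Lemma tensor_piP m n : tensor_pi m = tensor_pi n <-> m - n \in N.
Proof. by rewrite Quotient.idealrBE; split => [/eqP|/eqP]. Qed.

Lemma tensor_piD : {morph tensor_pi : m n / m + n}.
Proof. by move=> m n; rewrite /tensor_pi !piE. Qed.

Lemma tensor_pi_surj x : exists m, x = tensor_pi m.
Proof. by exists (repr (x : Quotient.quot N)); rewrite /tensor_pi reprK. Qed.

Definition tensor_scale (a : F) (x : T) : T :=
  tensor_pi (a *: repr (x : Quotient.quot N)).

Lemma tensor_scale_pi a m : tensor_scale a (tensor_pi m) = tensor_pi (a *: m).
Proof.
apply/tensor_piP; rewrite -scalerBr rpredZ //.
by apply/tensor_piP; rewrite /tensor_pi reprK.
Qed.

Fact tensor_scaleA a b x : tensor_scale a (tensor_scale b x) = tensor_scale (a * b) x.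
Proof. by have [m ->] := tensor_pi_surj x; rewrite !tensor_scale_pi scalerA. Qed.
Fact tensor_scale1 : left_id 1 tensor_scale.
Proof. by move=> x; have [m ->] := tensor_pi_surj x; rewrite tensor_scale_pi scale1r. Qed.
Fact tensor_scaleDr : right_distributive tensor_scale +%R.
Proof.
move=> a x y; have [m ->] := tensor_pi_surj x; have [n ->] := tensor_pi_surj y.
by rewrite -tensor_piD !tensor_scale_pi -tensor_piD scalerDr.
Qed.
Fact tensor_scaleDl x : {morph tensor_scale^~ x : a b / a + b}.
Proof.
move=> a b; have [m ->] := tensor_pi_surj x.
by rewrite !tensor_scale_pi -tensor_piD scalerDl.
Qed.

HB.instance Definition _ := GRing.Zmodule_isLmodule.Build F T
  tensor_scaleA tensor_scale1 tensor_scaleDr tensor_scaleDl.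

Lemma tensor_pi_linear : linear tensor_pi.
Proof. by move=> a m n; rewrite tensor_piD -tensor_scale_pi. Qed.

Definition tpure (u : U) (v : V) : T := tensor_pi << (u, v) >>.

Lemma tpure_linl v : linear (tpure^~ v).
Proof.
move=> a u u'; rewrite /tpure -tensor_pi_linear; apply/tensor_piP.
by apply: mem_span; apply: TensorRelL.
Qed.

Lemma tpure_linr u : linear (tpure u).
Proof.
move=> a v v'; rewrite /tpure -tensor_pi_linear; apply/tensor_piP.
by apply: mem_span; apply: TensorRelR.
Qed.

Lemma tensor_sum x : exists s : seq (U * V), x = \sum_(p <- s) tpure p.1 p.2.
Proof.
have [m ->] := tensor_pi_surj x; rewrite [m]malg_lin lin_sum; last exact: tensor_pi_linear.
exists [seq (m@_k *: k.1, k.2) | k <- msupp m].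
rewrite big_map; apply: eq_bigr => -[u v] _ /=.
by rewrite (linZ tensor_pi_linear) (linZ (tpure_linl v)).
Qed.

Variable W : lmodType F.

Lemma tensor_ext (g h : T -> W) : linear g -> linear h ->
  (forall u v, g (tpure u v) = h (tpure u v)) -> g =1 h.
Proof.
move=> lg lh e x; have [s ->] := tensor_sum x; rewrite !lin_sum //.
by apply: eq_bigr.
Qed.

(* The linear map induced by a bilinear map f.                                *)
Definition tlift (f : U -> V -> W) (x : T) : W :=
  mlift (fun p => f p.1 p.2) (repr (x : Quotient.quot N)).

Variable f : U -> V -> W.
Hypotheses (fl : forall v, linear (f^~ v)) (fr : forall u, linear (f u)).

Lemma tlift_pi m : tlift f (tensor_pi m) = mlift (fun p => f p.1 p.2) m.
Proof.
have lin := mlift_linear (fun p : U * V => f p.1 p.2).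
set m' := repr (tensor_pi m : Quotient.quot N).
suff : m' - m \in [pred z | mlift (fun p => f p.1 p.2) z == 0].
  rewrite inE addrC -scaleN1r lin scaleN1r addrC subr_eq0 => /eqP h.
  by rewrite /tlift -/m' h.
have : m' - m \in N by apply/tensor_piP; rewrite /tensor_pi reprK.
apply: span_sub.
  by apply: (@lin_ker_closed _ _ _ _ (fun=> 0)) => // a x y; rewrite scaler0 addr0.
by move=> _ [a u u' v|a u v v'];
  rewrite inE addrC -scaleN1r lin scaleN1r lin !mliftU /= ?fl ?fr addNr.
Qed.

Lemma tlift_linear : linear (tlift f).
Proof.
move=> a x y; have [m ->] := tensor_pi_surj x; have [n ->] := tensor_pi_surj y.
by rewrite -tensor_pi_linear !tlift_pi mlift_linear.
Qed.

Lemma tlift_pure u v : tlift f (tpure u v) = f u v.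
Proof. by rewrite tlift_pi mliftU. Qed.
End Tensor.

(* Tensor product of algebras: (a (x) b)(a' (x) b') = aa' (x) bb'.            *)

Section TensorAlgebra.
Variables (F : fieldType) (A B : algebra F).
Local Notation T := (tensor A B).

Definition tensor_mul (x y : T) : T :=
  tlift (fun (a : A) (b : B) =>
    tlift (fun (a' : A) (b' : B) => tpure (a * a') (b * b')) y) x.

Let inner_l (a : A) (b : B) b' : linear (fun a' : A => tpure (a * a') (b * b')).
Proof. by move=> c x y; rewrite algMlinr tpure_linl. Qed.
Let inner_r (a : A) (b : B) a' : linear (fun b' : B => tpure (a * a') (b * b')).
Proof. by move=> c x y; rewrite algMlinr tpure_linr. Qed.

Let outer_l y (b : B) :
  linear (fun a : A => tlift (fun (a' : A) (b' : B) => tpure (a * a') (b * b')) y).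
Proof.
move=> c a1 a2; have [s ->] := tensor_sum y.
rewrite !(lin_sum _ _ _ (tlift_linear (inner_l _ _) (inner_r _ _))).
rewrite scaler_sumr -big_split; apply: eq_bigr => p _.
by rewrite /= !tlift_pure // algMlinl tpure_linl.
Qed.
Let outer_r y (a : A) :
  linear (fun b : B => tlift (fun (a' : A) (b' : B) => tpure (a * a') (b * b')) y).
Proof.
move=> c b1 b2; have [s ->] := tensor_sum y.
rewrite !(lin_sum _ _ _ (tlift_linear (inner_l _ _) (inner_r _ _))).
rewrite scaler_sumr -big_split; apply: eq_bigr => p _.
by rewrite /= !tlift_pure // algMlinl tpure_linr.
Qed.

Lemma tensor_mulE (a a' : A) (b b' : B) :
  tensor_mul (tpure a b) (tpure a' b') = tpure (a * a') (b * b').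
Proof. by rewrite /tensor_mul !tlift_pure. Qed.

Lemma tensor_mul_linl y : linear (tensor_mul^~ y).
Proof. exact: tlift_linear. Qed.

Lemma tensor_mul_linr x : linear (tensor_mul x).
Proof.
move=> c y z; have [s ->] := tensor_sum x.
rewrite !(lin_sum _ _ _ (tensor_mul_linl _)) scaler_sumr -big_split.
by apply: eq_bigr => p _; rewrite /= /tensor_mul !tlift_pure // tlift_linear.
Qed.

Lemma tensor_mul_suml (I : Type) (r : seq I) (E : I -> T) y :
  tensor_mul (\sum_(i <- r) E i) y = \sum_(i <- r) tensor_mul (E i) y.
Proof. exact: lin_sum (tensor_mul_linl y). Qed.

Lemma tensor_mul_sumr (I : Type) (r : seq I) (E : I -> T) x :
  tensor_mul x (\sum_(i <- r) E i) = \sum_(i <- r) tensor_mul x (E i).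
Proof. exact: lin_sum (tensor_mul_linr x). Qed.

Lemma tensor_mulA : associative tensor_mul.
Proof.
move=> x y z; have [s ->] := tensor_sum x.
rewrite !tensor_mul_suml; apply: eq_bigr => p _.
have [t ->] := tensor_sum y.
rewrite tensor_mul_suml !tensor_mul_sumr tensor_mul_suml; apply: eq_bigr => q _.
have [u ->] := tensor_sum z.
rewrite !tensor_mul_sumr; apply: eq_bigr => r _.
by rewrite !tensor_mulE !mulrA.
Qed.

Lemma tensor_mul1x : left_id (tpure (1 : A) (1 : B)) tensor_mul.
Proof.
move=> x; have [s ->] := tensor_sum x.
rewrite tensor_mul_sumr; apply: eq_bigr => p _.
by rewrite tensor_mulE !mul1r.
Qed.

Lemma tensor_mulx1 : right_id (tpure (1 : A) (1 : B)) tensor_mul.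
Proof.
move=> x; have [s ->] := tensor_sum x.
rewrite tensor_mul_suml; apply: eq_bigr => p _.
by rewrite tensor_mulE !mulr1.
Qed.

Definition tensor_alg : algebra F := @Algebra F (tensor A B) (tpure (1 : A) (1 : B))
  tensor_mul tensor_mulA tensor_mul1x tensor_mulx1 tensor_mul_linl tensor_mul_linr.
End TensorAlgebra.

Definition subalgebra_closed (F : fieldType) (A : algebra F) (S : {pred A}) :=
  [/\ submod_closed S, 1 \in S & {in S &, forall x y, x * y \in S}].

Definition subalg_sort (F : fieldType) (A : algebra F) (S : {pred A})
  (SP : subalgebra_closed S) : Type := {x : A | x \in S}.

Section SubAlgebra.
Variables (F : fieldType) (A : algebra F) (S : {pred A}).
Hypothesis SP : subalgebra_closed S.
Local Notation B := (subalg_sort SP).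

Let S_ : {pred A} := S.
HB.instance Definition _ := GRing.isSubmodClosed.Build F A S_
  (let: And3 P _ _ := SP in P).
HB.instance Definition _ := SubChoice.copy B {x : A | x \in S_}.
HB.instance Definition _ := [SubChoice_isSubLmodule of B by <:].

Definition subalg_val (x : B) : A := val x.

Fact subalg_val_linear : linear subalg_val.
Proof. by move=> a x y; rewrite /subalg_val linearP. Qed.

Fact subalg_mul_in (x y : B) : val x * val y \in S.
Proof. by case: SP => _ _; apply; apply: (valP (_ : B)). Qed.
Definition subalg_one : B := exist _ 1 (let: And3 _ P _ := SP in P).
Definition subalg_mul (x y : B) : B := exist _ (val x * val y) (subalg_mul_in x y).

Fact subalg_mulA : associative subalg_mul.
Proof. by move=> x y z; apply: val_inj; rewrite /= mulrA. Qed.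
Fact subalg_mul1x : left_id subalg_one subalg_mul.
Proof. by move=> x; apply: val_inj; rewrite /= mul1r. Qed.
Fact subalg_mulx1 : right_id subalg_one subalg_mul.
Proof. by move=> x; apply: val_inj; rewrite /= mulr1. Qed.
Fact subalg_mul_linl y : linear (subalg_mul^~ y).
Proof.
move=> a x x'; apply: val_inj; rewrite [RHS]subalg_val_linear /=.
by rewrite [X in X * _]subalg_val_linear algMlinl.
Qed.
Fact subalg_mul_linr x : linear (subalg_mul x).
Proof.
move=> a y y'; apply: val_inj; rewrite [RHS]subalg_val_linear /=.
by rewrite [X in _ * X]subalg_val_linear algMlinr.
Qed.

Definition subalgebra : algebra F := @Algebra F B subalg_one subalg_mul
  subalg_mulA subalg_mul1x subalg_mulx1 subalg_mul_linl subalg_mul_linr.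
End SubAlgebra.

(* V is the internal direct sum of the family of subsets W of V.              *)

Definition direct_sum (F : fieldType) (V : lmodType F) (I : choiceType)
    (W : I -> {pred V}) : Prop :=
  (forall x, exists s : seq I, exists f : I -> V,
     (forall i, f i \in W i) /\ x = \sum_(i <- s) f i) /\
  (forall (s : seq I) (f : I -> V), uniq s -> (forall i, f i \in W i) ->
     \sum_(i <- s) f i = 0 -> {in s, forall i, f i = 0}).

Record graded_algebra (F : fieldType) (G : groupType) := GradedAlgebra {
  gr_alg :> algebra F;
  gr_comp : G -> {pred gr_alg};
  gr_comp_closed : forall g, submod_closed (gr_comp g);
  gr_direct : direct_sum gr_comp;
  gr_compM : forall g h, {in gr_comp g & gr_comp h,
    forall x y, x * y \in gr_comp (g * h)%g}
}.

Arguments gr_comp {F G} A g : rename.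
Arguments gr_comp_closed {F G} A g : rename.
Arguments gr_direct {F G} A : rename.
Arguments gr_compM {F G} A g h : rename.

Definition graded_iso (F : fieldType) (G : groupType)
    (A B : graded_algebra F G) : Prop :=
  exists f : A -> B, [/\ bijective f, linear f, GRing.monoid_morphism f &
    forall g x, x \in gr_comp A g -> f x \in gr_comp B g].

Section DirectSum.
Variables (F : fieldType) (V : lmodType F) (I : choiceType).
Implicit Types (f : I -> V) (s u : seq I).

Lemma sum_by_value s u f : uniq u -> {subset s <= u} ->
  \sum_(i <- s) f i = \sum_(j <- u) \sum_(i <- s | i == j) f i.
Proof.
move=> uu su; rewrite (exchange_big_dep xpredT) //= big_seq [RHS]big_seq.
apply: eq_bigr => i /su iu; rewrite [RHS]big_mkcond (bigD1_seq i) //= eqxx.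
by rewrite big1 ?addr0 // => j; rewrite eq_sym => /negPf ->.
Qed.

Variable W : I -> {pred V}.
Hypotheses (cW : forall i, submod_closed (W i)) (dW : direct_sum W).

Let W_mul i a x y : x \in W i -> y \in W i -> a *: x + y \in W i.
Proof. exact: (cW i).2. Qed.

Lemma direct_sum_unique s t f h :
  (forall i, f i \in W i) -> (forall i, h i \in W i) ->
  \sum_(i <- s) f i = \sum_(i <- t) h i ->
  forall j, \sum_(i <- s | i == j) f i = \sum_(i <- t | i == j) h i.
Proof.
move=> Wf Wh e j; pose u := undup (j :: s ++ t).
pose d k := \sum_(i <- s | i == k) f i - \sum_(i <- t | i == k) h i.
have Wd k : d k \in W k.
  rewrite /d addrC -scaleN1r; apply: W_mul; apply: closed_sum => // i _ /eqP -> //.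
have : \sum_(k <- u) d k = 0.
  rewrite sumrB -!sum_by_value ?undup_uniq ?e ?subrr //.
    by move=> i it; rewrite mem_undup inE mem_cat it !orbT.
  by move=> i is_; rewrite mem_undup inE mem_cat is_ !orbT.
move/(dW.2 _ _ (undup_uniq _) Wd)/(_ j) => h0.
by apply/eqP; rewrite -subr_eq0 -/(d j) h0 // mem_undup inE eqxx.
Qed.

Definition dproj_seq x : seq I := projT1 (cid (dW.1 x)).
Definition dproj_fun x : I -> V := projT1 (cid (projT2 (cid (dW.1 x)))).

Definition dproj j x : V := \sum_(i <- dproj_seq x | i == j) dproj_fun x i.

Lemma dproj_funP x : (forall i, dproj_fun x i \in W i) /\
  x = \sum_(i <- dproj_seq x) dproj_fun x i.
Proof. exact: (projT2 (cid (projT2 (cid (dW.1 x))))). Qed.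

Lemma dprojE j s f : (forall i, f i \in W i) ->
  dproj j (\sum_(i <- s) f i) = \sum_(i <- s | i == j) f i.
Proof.
move=> Wf; have [Wp e] := dproj_funP (\sum_(i <- s) f i).
by apply: direct_sum_unique => //; rewrite -e.
Qed.

Lemma dproj_in j x : dproj j x \in W j.
Proof.
have [Wp _] := dproj_funP x.
by apply: closed_sum => // i _ /eqP ->.
Qed.

Let single j x : x \in W j -> forall i, (if i == j then x else 0) \in W i.
Proof. by move=> Wx i; case: eqP => [->|_] //; exact: (cW i).1. Qed.

Lemma dproj_id j x : x \in W j -> dproj j x = x.
Proof.
move=> Wx; have := dprojE j [:: j] (single Wx).
by rewrite big_seq1 big_mkcond big_seq1 !eqxx.
Qed.

Lemma dproj_0 j k x : x \in W k -> k != j -> dproj j x = 0.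
Proof.
move=> Wx nkj; have := dprojE j [:: k] (single Wx).
by rewrite big_seq1 big_mkcond big_seq1 eqxx (negPf nkj).
Qed.

Lemma dproj_sum x : exists u, uniq u /\ x = \sum_(j <- u) dproj j x.
Proof.
exists (undup (dproj_seq x)); split; first exact: undup_uniq.
rewrite {1}(dproj_funP x).2; apply: sum_by_value; first exact: undup_uniq.
by move=> i; rewrite mem_undup.
Qed.

Lemma dproj_linear j : linear (dproj j).
Proof.
move=> a x y; have [Wx ex] := dproj_funP x; have [Wy ey] := dproj_funP y.
pose s := dproj_seq x; pose t := dproj_seq y.
pose u := undup (j :: s ++ t).
pose d k := a *: dproj k x + dproj k y.
have Wd k : d k \in W k by apply: W_mul; apply: dproj_in.
have -> : a *: x + y = \sum_(k <- u) d k.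
  rewrite big_split -scaler_sumr /= -!sum_by_value ?undup_uniq -?ex -?ey //.
    by move=> i it; rewrite mem_undup inE mem_cat it !orbT.
  by move=> i is_; rewrite mem_undup inE mem_cat is_ !orbT.
rewrite (dprojE j u Wd) big_mkcond (bigD1_seq j) ?undup_uniq //=; last first.
  by rewrite mem_undup inE eqxx.
by rewrite eqxx big1 ?addr0 // => k /negPf ->.
Qed.

Lemma direct_sum_proj (f : I -> V) s : uniq s -> (forall i, f i \in W i) ->
  {in s, forall j, dproj j (\sum_(i <- s) f i) = f j}.
Proof.
move=> us Wf j js; rewrite dprojE // big_mkcond (bigD1_seq j) //= eqxx.
by rewrite big1 ?addr0 // => k /negPf ->.
Qed.

Lemma direct_sum_ext (Z : lmodType F) (g h : V -> Z) : linear g -> linear h ->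
  (forall i x, x \in W i -> g x = h x) -> g =1 h.
Proof.
move=> lg lh e x; have [Wp ->] := dproj_funP x.
by rewrite !lin_sum //; apply: eq_bigr => i _; apply: e (Wp i).
Qed.
End DirectSum.

Lemma gr_comp1 (F : fieldType) (G : groupType) (A : graded_algebra F G) :
  1 \in gr_comp A 1%g.
Proof.
have cA := gr_comp_closed A; have dA := gr_direct A.
pose p := dproj dA; have lp g : linear (p g) := dproj_linear cA dA g.
suff e : (fun x : A => p 1%g 1 * x) =1 id.
  by rewrite -[1](e 1) mulr1; apply: dproj_in.
apply: (direct_sum_ext dA) => [|//|g x Ax]; first exact: algMlinr.
have e : (fun y : A => p 1%g y * x) =1 (fun y : A => p g (y * x)).
  apply: (direct_sum_ext dA) => [a y z|a y z|h y Ay].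
  - by rewrite lp algMlinl.
  - by rewrite algMlinl lp.
  - have Ayx := gr_compM A _ _ _ _ Ay Ax.
    have [h1|n1] := eqVneq h 1%g.
      by rewrite h1 ?mul1g in Ay Ayx; rewrite /p !(dproj_id cA).
    rewrite /p (dproj_0 cA _ Ay n1) mul0r (dproj_0 cA _ Ayx) //.
    by apply: contra n1 => /eqP; rewrite -[RHS]mul1g => /mulIg ->.
by rewrite e mul1r /p (dproj_id cA).
Qed.

(* The graded product: its g-component is the subspace A_g (x) B_g of the     *)
(* tensor product algebra, and the subalgebra is the sum of these subspaces.  *)

Section GradedProduct.
Variables (F : fieldType) (G : groupType) (A B : graded_algebra F G).
Local Notation T := (tensor_alg A B).

Definition tensor_comp (g : G) : {pred T} :=
  span (fun z : T => exists a b,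
    [/\ a \in gr_comp A g, b \in gr_comp B g & z = tpure a b]).

Definition graded_tensor : {pred T} :=
  span (fun z : T => exists g, z \in tensor_comp g).

Lemma tensor_comp_closed g : submod_closed (tensor_comp g).
Proof. exact: span_closed. Qed.

Lemma tensor_comp_pure g a b : a \in gr_comp A g -> b \in gr_comp B g ->
  tpure a b \in tensor_comp g.
Proof. by move=> Aa Bb; apply: mem_span; exists a, b. Qed.

Lemma tensor_comp_sub g : {subset tensor_comp g <= graded_tensor}.
Proof. by move=> x Tx; apply: mem_span; exists g. Qed.

Lemma span_ext (V W : lmodType F) (S : V -> Prop) (f h : V -> W) :
  linear f -> linear h -> (forall x, S x -> f x = h x) ->
  {in span S, f =1 h}.
Proof.
move=> lf lh e x Sx; apply/eqP.
by apply: (span_sub (lin_ker_closed lf lh) _ Sx) => y Sy; apply/eqP/e.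
Qed.

Lemma span_lin (V W : lmodType F) (S : V -> Prop) (f : V -> W) (P : {pred W}) :
  linear f -> submod_closed P -> (forall x, S x -> f x \in P) ->
  forall x, x \in span S -> f x \in P.
Proof.
move=> lf [P0 cP] e; apply: (span_sub (P := [pred x | f x \in P])) => //.
split=> [|a u v]; first by change (f 0 \in P); rewrite lin0.
by move=> fu fv; change (f (a *: u + v) \in P); rewrite lf; apply: cP.
Qed.

Lemma tensor_compM g h : {in tensor_comp g & tensor_comp h,
  forall x y, x * y \in tensor_comp (g * h)%g}.
Proof.
move=> x y Tx Ty; move: x Tx.
apply: (span_lin (algMlinl y)) => [|_ [a [b [Aa Bb ->]]]].
  exact: tensor_comp_closed.
move: y Ty; apply: (span_lin (algMlinr _)) => [|_ [a' [b' [Aa' Bb' ->]]]].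
  exact: tensor_comp_closed.
by rewrite [_ * _]tensor_mulE; apply: tensor_comp_pure; apply: gr_compM.
Qed.

Lemma graded_tensor_closed : subalgebra_closed graded_tensor.
Proof.
have cS : submod_closed graded_tensor by apply: span_closed.
split=> //.
  apply: (@tensor_comp_sub 1%g); apply: tensor_comp_pure; exact: gr_comp1.
move=> x y Tx Ty; move: x Tx; apply: (span_lin (algMlinl y)) => // x [g Tx].
move: y Ty; apply: (span_lin (algMlinr x)) => // y [h Ty].
by apply: (@tensor_comp_sub (g * h)%g); apply: tensor_compM.
Qed.

Definition graded_product_alg : algebra F := subalgebra graded_tensor_closed.

Definition graded_product_comp (g : G) : {pred graded_product_alg} :=
  [pred x | subalg_val x \in tensor_comp g].

Definition tensor_proj (g : G) : T -> T :=
  tlift (fun (a : A) (b : B) => tpure (dproj (gr_direct A) g a)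
                                      (dproj (gr_direct B) g b)).

Lemma tensor_projl g (b : B) : linear (fun a : A =>
  tpure (dproj (gr_direct A) g a) (dproj (gr_direct B) g b)).
Proof. by move=> c x y; rewrite dproj_linear ?tpure_linl //; apply: gr_comp_closed. Qed.

Lemma tensor_projr g (a : A) : linear (fun b : B =>
  tpure (dproj (gr_direct A) g a) (dproj (gr_direct B) g b)).
Proof. by move=> c x y; rewrite dproj_linear ?tpure_linr //; apply: gr_comp_closed. Qed.

Lemma tensor_proj_linear g : linear (tensor_proj g).
Proof. by apply: tlift_linear => ?; [apply: tensor_projl|apply: tensor_projr]. Qed.

Lemma tensor_proj_pure g (a : A) (b : B) : tensor_proj g (tpure a b) =
  tpure (dproj (gr_direct A) g a) (dproj (gr_direct B) g b).
Proof. by apply: tlift_pure => ?; [apply: tensor_projl|apply: tensor_projr]. Qed.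

Lemma tensor_proj_id g : {in tensor_comp g, tensor_proj g =1 id}.
Proof.
apply: span_ext => [|//|_ [a [b [Aa Bb ->]]]]; first exact: tensor_proj_linear.
by rewrite tensor_proj_pure !dproj_id //; apply: gr_comp_closed.
Qed.

Lemma tensor_proj_0 g h : h != g -> {in tensor_comp h, tensor_proj g =1 fun=> 0}.
Proof.
move=> hg; apply: span_ext => [|a x y|_ [a [b [Aa Bb ->]]]].
- exact: tensor_proj_linear.
- by rewrite scaler0 addr0.
- rewrite tensor_proj_pure (dproj_0 (gr_comp_closed A) _ Aa hg).
  exact: lin0 (tpure_linl _).
Qed.

Lemma graded_tensor_sum x : x \in graded_tensor ->
  exists s : seq G, exists f : G -> T,
    (forall g, f g \in tensor_comp g) /\ x = \sum_(g <- s) f g.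
Proof.
move=> Tx; suff [s [sP ->]] : exists s : seq (G * T),
    (forall p, p \in s -> p.2 \in tensor_comp p.1) /\ x = \sum_(p <- s) p.2.
  exists (undup [seq p.1 | p <- s]), (fun g => \sum_(p <- s | p.1 == g) p.2).
  split=> [g|].
    by apply: closed_sum (tensor_comp_closed g) _ => p /sP Tp /eqP <-.
  rewrite (exchange_big_dep xpredT) //= big_seq [RHS]big_seq.
  apply: eq_bigr => p ps; rewrite big_mkcond (bigD1_seq p.1) ?undup_uniq //=.
    by rewrite eqxx big1 ?addr0 // => g; rewrite eq_sym => /negPf ->.
  by rewrite mem_undup map_f.
apply/asboolP; pose P : {pred T} := [pred x | `[< exists s : seq (G * T),
  (forall p, p \in s -> p.2 \in tensor_comp p.1) /\ x = \sum_(p <- s) p.2 >]].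
apply: (span_sub (P := P) _ _ Tx).
  split=> [|a u v]; first by apply/asboolP; exists [::]; rewrite big_nil.
  move=> /asboolP[s [sP ->]] /asboolP[t [tP ->]]; apply/asboolP.
  exists ([seq (p.1, a *: p.2) | p <- s] ++ t); split=> [p|].
    rewrite mem_cat => /orP[/mapP[q qs ->]|/tP //] /=.
    rewrite -[_ *: _]addr0; apply: (tensor_comp_closed _).2; first exact: sP.
    exact: (tensor_comp_closed _).1.
  by rewrite big_cat big_map /= scaler_sumr.
move=> y [g Ty]; apply/asboolP; exists [:: (g, y)]; rewrite big_seq1; split=> //.
by move=> p; rewrite inE => /eqP ->.
Qed.

Lemma graded_product_comp_closed g : submod_closed (graded_product_comp g).
Proof.
have [T0 cT] := tensor_comp_closed g; split=> [|a u v].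
  change (subalg_val (SP := graded_tensor_closed) 0 \in tensor_comp g).
  by rewrite (lin0 (subalg_val_linear (SP := graded_tensor_closed))).
move=> Tu Tv; change (subalg_val (SP := graded_tensor_closed) (a *: u + v) \in tensor_comp g).
by rewrite subalg_val_linear; apply: cT.
Qed.

Lemma graded_product_direct : direct_sum graded_product_comp.
Proof.
pose v := subalg_val (SP := graded_tensor_closed).
have lv : linear v := subalg_val_linear (SP := graded_tensor_closed).
split=> [x|s f us Tf e g gs].
  have [s [f [Tf e]]] := graded_tensor_sum (valP x).
  exists s, (fun g => exist _ (f g) (tensor_comp_sub (Tf g))); split=> //.
  by apply: val_inj; rewrite /= e; symmetry; exact: (lin_sum _ _ _ lv).
apply: val_inj; rewrite -[LHS](tensor_proj_id (Tf g)).
have e0 : \sum_(h <- s) v (f h) = 0.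
  transitivity (v (\sum_(h <- s) f h)).
    by symmetry; exact: (lin_sum _ _ _ lv).
  by rewrite e; exact: (lin0 lv).
have : \sum_(h <- s) tensor_proj g (v (f h)) = 0.
  transitivity (tensor_proj g (\sum_(h <- s) v (f h))).
    by symmetry; exact: (lin_sum _ _ _ (tensor_proj_linear g)).
  by rewrite e0; exact: (lin0 (tensor_proj_linear g)).
rewrite (bigD1_seq g) //= big1 ?addr0 => [->|h hg].
  by symmetry; exact: (lin0 lv).
exact: tensor_proj_0 hg _ (Tf h).
Qed.

Lemma graded_product_compM g h :
  {in graded_product_comp g & graded_product_comp h,
    forall x y, x * y \in graded_product_comp (g * h)%g}.
Proof. by move=> x y Tx Ty; apply: tensor_compM. Qed.

Definition graded_product : graded_algebra F G := @GradedAlgebra F G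
  graded_product_alg graded_product_comp graded_product_comp_closed
  graded_product_direct graded_product_compM.
End GradedProduct.

(* The group algebra FG: the free vector space on G with convolution.         *)

Section GroupAlgebra.
Variables (F : fieldType) (G : groupType).
Local Notation FG := {malg F[G]}.

Definition galg_mul (a b : FG) : FG :=
  \sum_(x <- msupp a) \sum_(y <- msupp b) (a@_x * b@_y) *: << (x * y)%g >>.

Lemma galg_mul_lift a b :
  galg_mul a b = mlift (fun x => mlift (fun y => << (x * y)%g >> : FG) b) a.
Proof.
apply: eq_bigr => x _; rewrite scaler_sumr; apply: eq_bigr => y _.
by rewrite scalerA.
Qed.

Lemma galg_mulU x y : galg_mul << x >> << y >> = << (x * y)%g >>.
Proof. by rewrite galg_mul_lift !mliftU. Qed.

Fact galg_mul_linl b : linear (galg_mul^~ b).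
Proof. by move=> c x y; rewrite !galg_mul_lift mlift_linear. Qed.

Fact galg_mul_linr a : linear (galg_mul a).
Proof.
move=> c x y; rewrite !galg_mul_lift /mlift scaler_sumr -big_split.
apply: eq_bigr => g _; rewrite -/(mlift _ (c *: x + y)) mlift_linear scalerDr.
by rewrite !scalerA mulrC.
Qed.

Lemma galg_mul_suml (r : seq G) (c : G -> F) (E : G -> FG) b :
  galg_mul (\sum_(x <- r) c x *: E x) b = \sum_(x <- r) c x *: galg_mul (E x) b.
Proof.
rewrite (lin_sum _ _ _ (galg_mul_linl b)); apply: eq_bigr => x _.
exact: linZ (galg_mul_linl b) _ _.
Qed.

Lemma galg_mul_sumr (r : seq G) (c : G -> F) (E : G -> FG) a :
  galg_mul a (\sum_(x <- r) c x *: E x) = \sum_(x <- r) c x *: galg_mul a (E x).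
Proof.
rewrite (lin_sum _ _ _ (galg_mul_linr a)); apply: eq_bigr => x _.
exact: linZ (galg_mul_linr a) _ _.
Qed.

Fact galg_mulA : associative galg_mul.
Proof.
move=> a b c; rewrite [a]malg_lin !galg_mul_suml; apply: eq_bigr => x _.
congr (_ *: _); rewrite [b]malg_lin galg_mul_suml !galg_mul_sumr galg_mul_suml.
apply: eq_bigr => y _; congr (_ *: _); rewrite [c]malg_lin !galg_mul_sumr.
by apply: eq_bigr => z _; rewrite !galg_mulU mulgA.
Qed.

Fact galg_mul1x : left_id << 1%g >> galg_mul.
Proof.
move=> a; rewrite [a]malg_lin galg_mul_sumr.
by apply: eq_bigr => x _; rewrite galg_mulU mul1g.
Qed.

Fact galg_mulx1 : right_id << 1%g >> galg_mul.
Proof.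
move=> a; rewrite [a]malg_lin galg_mul_suml.
by apply: eq_bigr => x _; rewrite galg_mulU mulg1.
Qed.

Definition group_algebra : algebra F := @Algebra F {malg F[G]} << 1%g >>
  galg_mul galg_mulA galg_mul1x galg_mulx1 galg_mul_linl galg_mul_linr.

Definition group_algebra_comp (g : G) : {pred group_algebra} :=
  [pred x : FG | `[< exists c : F, x = c *: << g >> >]].

Lemma group_algebra_comp_closed g : submod_closed (group_algebra_comp g).
Proof.
split=> [|a u v]; first by apply/asboolP; exists 0; rewrite scale0r.
move=> /asboolP[c ->] /asboolP[d ->]; apply/asboolP; exists (a * c + d).
by rewrite scalerDl scalerA.
Qed.

Lemma group_algebra_direct : direct_sum group_algebra_comp.
Proof.
split=> [x|s f us fP e g gs].
  exists (msupp (x : FG)), (fun g => (x : FG)@_g *: << g >>); split=> [g|].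
    by apply/asboolP; exists ((x : FG)@_g).
  exact: malg_lin.
have {}fP h : exists c : F, f h = c *: << h >> by apply/asboolP/fP.
have [c ec] := choice fP.
have : mcoeff g (\sum_(h <- s) f h : FG) = 0.
  by rewrite (_ : \sum_(h <- s) f h = 0) // mcoeff0.
rewrite raddf_sum (bigD1_seq g) //= big1 ?addr0 => [|h hg].
  by rewrite ec mcoeffZ mcoeffUU mulr1 => ->; rewrite scale0r.
by rewrite ec mcoeffZ mcoeffU (negPf hg) mulr0.
Qed.

Lemma group_algebra_compM g h :
  {in group_algebra_comp g & group_algebra_comp h,
    forall x y, x * y \in group_algebra_comp (g * h)%g}.
Proof.
move=> x y /asboolP[c ->] /asboolP[d ->]; apply/asboolP; exists (c * d).
change (galg_mul (c *: << g >>) (d *: << h >>) = (c * d) *: << (g * h)%g >>).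
rewrite (linZ (galg_mul_linl _)) (linZ (galg_mul_linr _)) galg_mulU.
by rewrite scalerA.
Qed.

Definition graded_group_algebra : graded_algebra F G := @GradedAlgebra F G
  group_algebra group_algebra_comp group_algebra_comp_closed
  group_algebra_direct group_algebra_compM.
End GroupAlgebra.

(* Gr(G, F): graded-isomorphism classes of the G-graded algebras of           *)
(* cardinality at most that of K, a class being the predicate of its members. *)

Definition card_bounded (F : fieldType) (G : groupType) (K : Type)
    (A : graded_algebra F G) : Prop :=
  ([set: A] #<= [set: K])%card.

Definition Gr (F : fieldType) (G : groupType) (K : Type) : Type :=
  {C : graded_algebra F G -> Prop |
    exists A, card_bounded K A /\ C = graded_iso A}.

Definition gr_class (F : fieldType) (G : groupType) (K : Type)
    (A : graded_algebra F G) (kA : card_bounded K A) : Gr F G K :=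
  exist _ (graded_iso A) (ex_intro _ A (conj kA erefl)).

Definition graded_product_rule (F : fieldType) (G : groupType) (K : Type)
    (op : Gr F G K -> Gr F G K -> Gr F G K) : Prop :=
  forall (A B : graded_algebra F G) (kA : card_bounded K A) (kB : card_bounded K B),
    exists kAB : card_bounded K (graded_product A B),
      op (gr_class kA) (gr_class kB) = gr_class kAB.

(* Main.v *)
Require Import Defs.
From mathcomp Require Import all_boot all_order all_algebra.
From mathcomp Require Import finmap monalg.
From mathcomp Require Import boolp classical_sets functions cardinality.
Set Implicit Arguments.
Unset Strict Implicit.
Unset Printing Implicit Defensive.
Import GRing.Theory.
Local Open Scope ring_scope.

(** The graded product behaves like a tensor product as long as one only looks
    at pure tensors of homogeneous elements of equal degree.  Concretely, there
    is a bilinear map [gpair : A -> B -> graded_product A B] sending [(a, b)] to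
    the sum over [g] of the tensors of the components [a_g] and [b_g].  On
    elements of one degree [g] it is the pure tensor, these values span the
    [g]-component ([gprod_comp_ind]), they multiply componentwise ([gpairM]), and
    every bilinear map on [A] and [B] induces a linear map on the graded product
    with the expected value on them ([gprod_lift]).  Everything about the
    operation follows from this interface.

    - Well-definedness, commutativity and associativity come from the maps
      sending [a (x) b] to [f a (x) h b], [a (x) b] to [b (x) a], and
      [(a (x) b) (x) c] to [a (x) (b (x) c)] ([gprod_map_iso], [gprodC_iso],
      [gprodA_iso]); multiplicativity and the identities between composites are
      checked on generators of equal degree.
    - The unit law [gprod_unit_iso] sends [a] of degree [g] to [a (x) g].  A
      different map is used in each degree, so these maps have to be glued along
      the direct sum decomposition ([dlift]).

    The operation stays among algebras of cardinality at most that of [K]: an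
    element of [graded_product A B] is a finite sum of pure tensors, hence is
    determined by a finite sequence of pairs, and an infinite [K] has as many
    finite sequences as elements.  The latter rests on the equipotency of
    [K * K] and [K] ([embeds_square]), obtained from Zorn's lemma.  *)

(** * Cardinal arithmetic of infinite types *)

Definition embeds (T U : Type) : Prop := exists f : T -> U, injective f.

Lemma card_leTT (T U : Type) : ([set: T] #<= [set: U])%card <-> embeds T U.
Proof.
elim/Ppointed: U => U; last first.
  split=> [/pcard_injP[f fI]|[f fI]].
    by exists f => x y; apply: fI; rewrite inE.
  by apply/pcard_injP; exists f => x y _ _; apply: fI.
rewrite [X in (_ #<= X)%card]empty_eq0.
split=> [/card_le0P T0|[f _]].
  have nT (t : T) : False by have : [set: T]%classic t by []; rewrite T0.
  by exists (fun t => False_rect _ (nT t)) => t; case: (nT t).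
by apply/card_le0P; rewrite -subset0 => t _; case: (no (f t)).
Qed.

Lemma embeds_trans T U V : embeds T U -> embeds U V -> embeds T V.
Proof. by move=> [f fI] [g gI]; exists (g \o f); apply: inj_comp. Qed.

Lemma embeds_prod T U T' U' : embeds T U -> embeds T' U' -> embeds (T * T') (U * U').
Proof.
move=> [f fI] [g gI]; exists (fun x => (f x.1, g x.2)).
by move=> [a b] [c d] [/fI-> /gI->].
Qed.

(** Zorn's lemma for sets [A] cut out by a condition on pairs of elements of [A]
    that survives enlarging [A].  Such conditions pass to unions of chains, since
    any two elements of the union lie in a common member of the chain. *)
Lemma maximal_relation (T : Type) (R : set T -> T -> T -> Prop) :
  (forall A B x y, (A `<=` B)%classic -> R A x y -> R B x y) ->
  exists A : set T, (forall x y, A x -> A y -> R A x y) /\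
    forall B : set T, (A `<=` B)%classic -> (forall x y, B x -> B y -> R B x y) ->
      (B `<=` A)%classic.
Proof.
move=> mR.
have [|A [RA maxA]] := @Zorn_bigcup T [set A | forall x y, A x -> A y -> R A x y]%classic.
  move=> C CR Ctot x y [X CX Xx] [Y CY Yy].
  have up Z : C Z -> (Z `<=` \bigcup_(X in C) X)%classic.
    by move=> CZ z Zz; exists Z.
  have [XY|YX] := Ctot _ _ CX CY.
    by apply: (mR _ _ _ _ (up _ CY)); apply: CR => //; apply: XY.
  by apply: (mR _ _ _ _ (up _ CX)); apply: CR => //; apply: YX.
exists A; split=> // B AB RB; apply: contrapT => nBA.
by apply: (maxA B) => //; split.
Qed.

(** In a maximal graph of a partial injection, an element outside the domain and
    one outside the range could be matched with each other. *)
Lemma embeds_total (T U : Type) : embeds T U \/ embeds U T.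
Proof.
have [|M [MI maxM]] := @maximal_relation (T * U)%type
  (fun _ x y => x.1 = y.1 <-> x.2 = y.2) => //.
have [Tdom|] := pselect (forall t, exists u, M (t, u)).
  have [f Mf] := choice Tdom; left; exists f => t t' e.
  exact: (MI _ _ (Mf t) (Mf t')).2.
move=> /existsNP[t /forallNP nt].
have [Udom|] := pselect (forall u, exists t, M (t, u)).
  have [f Mf] := choice Udom; right; exists f => u u' e.
  exact: (MI _ _ (Mf u) (Mf u')).1.
move=> /existsNP[u /forallNP nu]; case: (nt u).
apply: (maxM [set x | M x \/ x = (t, u)]%classic) => [x|x y|]; [by left| |by right].
move=> [Mx|->] [My|->] //=; first exact: MI.
  by split=> e; [case: (nt x.2)|case: (nu x.1)]; rewrite -e -surjective_pairing.
by split=> e; [case: (nt y.2)|case: (nu y.1)]; rewrite e -surjective_pairing.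
Qed.

(** The union of two parts of [K] embeds into a disjoint union of two copies of
    [M], and the latter sits in [M * M], hence in [M]. *)
Lemma glue_embeds (K M : Type) (S : set K) (P : set K)
  (p : M * M -> M) (m0 m1 : M) (f : {x | S x} -> M) (g : {x | P x} -> M) :
  injective p -> m0 <> m1 -> injective f -> injective g ->
  exists v : K -> M, forall x y, S x \/ P x -> S y \/ P y -> v x = v y -> x = y.
Proof.
move=> pI m01 fI gI.
exists (fun x => if pselect (S x) is left Sx then p (m0, f (exist _ x Sx)) else
  if pselect (P x) is left Px then p (m1, g (exist _ x Px)) else m0).
move=> x y hx hy.
case: (pselect (S x)) => [Sx|nSx]; case: (pselect (S y)) => [Sy|nSy].
- by move/pI => -[] /fI[].
- case: (pselect (P y)) => [Py|nPy]; last by case: hy.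
  by move/pI => -[].
- case: (pselect (P x)) => [Px|nPx]; last by case: hx.
  by move/pI => -[/esym].
- case: (pselect (P x)) => [Px|nPx]; last by case: hx.
  case: (pselect (P y)) => [Py|nPy]; last by case: hy.
  by move/pI => -[] /gI[].
Qed.

(** A set [M] of triples satisfying [sqrel] pairwise is the graph of an injection
    from [S * S] to [S], where [S] is its field [sqfield M]. *)
Definition sqfield (K : Type) (M : set ((K * K) * K)) : set K :=
  [set a | exists c, M ((a, a), c)]%classic.

Definition sqrel (K : Type) (M : set ((K * K) * K)) (x y : (K * K) * K) : Prop :=
  [/\ x.1 = y.1 <-> x.2 = y.2, exists c, M ((x.1.1, y.1.1), c) &
      [/\ sqfield M x.1.1, sqfield M x.1.2 & sqfield M x.2]].

(** Take a maximal graph of an injection from [S * S] to [S], for [S] a part of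
    [K].  If the complement of [S] embeds into [S], then so does [K], and
    [K * K] embeds into [S * S], hence into [S].  Otherwise [S] has a disjoint
    copy [T] in its complement; the pairs of elements of the union of [S] and [T]
    that are not in [S * S] can be injected into [T], which contradicts
    maximality.  When [S] has at most one element, a copy of [nat] plays the
    role of [T]. *)
Lemma embeds_square (K : Type) : embeds nat K -> embeds (K * K) K.
Proof.
move=> [k kI].
have [A B x y AB [h [c /AB ?] [[d /AB ?] [d' /AB ?] [e /AB ?]]]|M [RM maxM]] :=
    @maximal_relation _ (@sqrel K).
  by split=> //; [exists c|split; [exists d|exists d'|exists e]].
pose S := sqfield M; pose E := {x : K | S x}.
have valI (P : set K) (a b : {x : K | P x}) : sval a = sval b -> a = b.
  by case: a b => [x Px] [y Py] /= e; apply: eq_exist.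
have ME (ab : E * E) : exists c : E, M ((sval ab.1, sval ab.2), sval c).
  case: ab => [[a [a' Ma]] [b [b' Mb]]] /=; have [_ [c Mc] _] := RM _ _ Ma Mb.
  by have [_ _ [_ _ Sc]] := RM _ _ Mc Mc; exists (exist _ c Sc).
have EE : embeds (E * E) E.
  have [f Mf] := choice ME; exists f => -[a b] [c d] e.
  have [/= h _ _] := RM _ _ (Mf (a, b)) (Mf (c, d)).
  have /h.2[/valI-> /valI->] // : sval (f (a, b)) = sval (f (c, d)) by rewrite e.
(* the image of N outside S is the set T by which S can be enlarged *)
have noext (N : Type) (n0 n1 : N) : n0 <> n1 -> embeds (N * N) N ->
    embeds E N -> ~ exists m : N -> K, injective m /\ forall n, ~ S (m n).
  move=> n01 [p pI] [i iI] [m [mI mS]].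
  pose P : set K := [set a | exists n, m n = a]%classic.
  have [g gP] := choice (fun a : {x | P x} => proj2_sig a).
  have gI : injective g by move=> a b e; apply: valI; rewrite -!gP e.
  have [v vI] := glue_embeds pI n01 iI gI.
  pose D a := S a \/ P a.
  pose z (ab : K * K) := m (p (v ab.1, v ab.2)).
  have zI a b : D a.1 -> D a.2 -> D b.1 -> D b.2 -> z a = z b -> a = b.
    case: a b => [a a'] [b b'] /= Da Da' Db Db' /mI/pI[e e'].
    by rewrite (vI _ _ Da Db e) (vI _ _ Da' Db' e').
  have zS ab : ~ S (z ab) := mS _.
  pose M' : set (K * K * K) := [set x | M x \/
    [/\ D x.1.1, D x.1.2, ~ (S x.1.1 /\ S x.1.2) & x.2 = z x.1]]%classic.
  have M'dom a b : D a -> D b -> exists c, M' ((a, b), c).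
    move=> Da Db; have [[Sa Sb]|nS] := pselect (S a /\ S b).
      have [c Mc] := ME (exist _ a Sa, exist _ b Sb).
      by exists (sval c); left.
    by exists (z (a, b)); right; split.
  have M'S a : D a -> sqfield M' a by move=> Da; apply: M'dom.
  have M'D x : M' x -> [/\ D x.1.1, D x.1.2 & D x.2].
    case=> [Mx|[D1 D2 _ ->]]; last by split=> //; right; exists (p (v x.1.1, v x.1.2)).
    by have [_ _ [S1 S2 S3]] := RM _ _ Mx Mx; split; left.
  have M'R x y : M' x -> M' y -> sqrel M' x y.
    move=> Mx My; have [D1 D2 D3] := M'D _ Mx; have [D1' D2' D3'] := M'D _ My.
    split; [|exact: M'dom|by split; apply: M'S].
    case: Mx My => [Mx|[_ _ nx ex]] [My|[_ _ ny ey]].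
    - by have [] := RM _ _ Mx My.
    - have [_ _ [S1 S2 S3]] := RM _ _ Mx Mx; rewrite ey.
      by split=> e; [case: ny; rewrite -e|case: (zS y.1); rewrite -e].
    - have [_ _ [S1 S2 S3]] := RM _ _ My My; rewrite ex.
      by split=> e; [case: nx; rewrite e|case: (zS x.1); rewrite e].
    - by rewrite ex ey; split=> [->|/zI] //; apply.
  have Dt : D (m n0) by right; exists n0.
  have : M (m n0, m n0, z (m n0, m n0)).
    apply: (maxM M') => //; first by move=> x Mx; left.
    by right; split=> // -[/mS].
  by move=> Mt; apply: (mS n0); exists (z (m n0, m n0)).
have [[e0 [e1 e01]]|E1] := pselect (exists e0 e1 : E, e0 <> e1).
  have [[i iI]|[i iI]] := embeds_total E {x : K | ~ S x}.
    case: (noext E e0 e1) => //; first by exists id.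
    exists (fun e => sval (i e)); split=> [e e' /valI/iI //|e].
    exact: (proj2_sig (i e)).
  have [p pI] := EE.
  have [v vI] := @glue_embeds K E S (fun x => ~ S x) p e0 e1 id i pI e01 (@inj_id _) iI.
  have KE : embeds K E by exists v => x y; apply: vI; apply: EM.
  apply: embeds_trans (embeds_prod KE KE) (embeds_trans EE _).
  by exists sval; apply: valI.
case: (noext nat 0%N 1%N) => //.
- by exists (choice.pickle : nat * nat -> nat); apply: pcan_inj choice.pickleK.
- exists (fun=> 0%N) => a b _; apply: contrapT => nab; apply: E1; by exists a, b.
(* S meets the sequence k at most once, so a tail of k avoids S *)
have [[n0 Sn0]|nS] := pselect (exists n, S (k n)).
  exists (fun n => k (n0 + n.+1)%N); split=> [n n' /kI/addnI[]//|n Sn].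
  apply: E1; exists (exist _ _ Sn0), (exist _ _ Sn) => -[/kI/eqP].
  by rewrite -[X in X == _]addn0 eqn_add2l.
by exists k; split=> // n Sn; apply: nS; exists n.
Qed.

(** Sequences of a fixed length are coded by iterating a pairing, and pairing the
    code with the length makes the decoding unambiguous. *)
Lemma embeds_seq (K : Type) : embeds nat K -> embeds (seq K) K.
Proof.
move=> kN; have [p pI] := embeds_square kN; have [k kI] := kN.
pose c := foldr (fun x y => p (x, y)) (k 0%N).
exists (fun s => p (k (size s), c s)) => s t /pI[/kI].
by elim: s t => [|x s IH] [|y t] //= [/IH{}IH] /pI[-> /IH->].
Qed.

Lemma embeds_seq_of (T K : Type) : embeds nat K -> embeds T K -> embeds (seq T) K.
Proof.
move=> kN [f fI]; apply: embeds_trans (embeds_seq kN).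
by exists (map f); apply: inj_map.
Qed.

(** * Linear maps glued along a direct sum *)

Section LinearClosure.
Variables (F : fieldType) (U V W : lmodType F).

Lemma lin_comp (f : V -> W) (g : U -> V) : linear f -> linear g -> linear (fun x => f (g x)).
Proof. by move=> lf lg a x y; rewrite lg lf. Qed.

Lemma lin_preim_closed (f : U -> V) (P : {pred V}) :
  linear f -> submod_closed P -> submod_closed [pred x | f x \in P].
Proof.
move=> lf [P0 cP]; split=> [|a u v]; rewrite !inE; first by rewrite lin0.
by move=> Pu Pv; rewrite lf; apply: cP.
Qed.

Lemma lin_bigsum (I : Type) (r : seq I) (f : I -> U -> V) :
  (forall i, linear (f i)) -> linear (fun x => \sum_(i <- r) f i x).
Proof.
move=> lf a x y; rewrite scaler_sumr -big_split /=.
by apply: eq_bigr => i _; apply: lf.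
Qed.

Lemma lin_inv (f : U -> V) (g : V -> U) : linear f -> cancel f g -> cancel g f -> linear g.
Proof. by move=> lf fK gK a x y; rewrite -{1}[x]gK -{1}[y]gK -lf fK. Qed.
End LinearClosure.

Section DirectLift.
Variables (F : fieldType) (V Z : lmodType F) (I : choiceType) (W : I -> {pred V}).
Hypotheses (cW : forall i, submod_closed (W i)) (dW : direct_sum W).
Variable h : I -> V -> Z.

(** The linear map that agrees with [h j] on [W j] for every [j]. *)
Definition dlift x : Z := \sum_(j <- undup (dproj_seq dW x)) h j (dproj dW j x).

Hypothesis hl : forall i, linear (h i).

(** The components of [x] outside [dproj_seq dW x] vanish, so enlarging the index
    set does not change the sum; this gives a common index set for several
    arguments, on which linearity is visible. *)
Lemma dliftE u x : uniq u -> {subset dproj_seq dW x <= u} ->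
  dlift x = \sum_(j <- u) h j (dproj dW j x).
Proof.
move=> uu su; rewrite [RHS](bigID (mem (dproj_seq dW x))) /=.
rewrite [X in _ + X]big1 ?addr0 => [|j nj].
  rewrite -big_filter; apply: perm_big; apply: uniq_perm.
  - exact: undup_uniq.
  - exact: filter_uniq.
  by move=> j; rewrite mem_undup mem_filter andb_idr //; apply: su.
rewrite /dproj big_seq_cond big_pred0 ?lin0 // => i.
by apply/andP => -[ij /eqP e]; rewrite -e ij in nj.
Qed.

Lemma dlift_linear : linear dlift.
Proof.
move=> a x y.
pose u := undup (dproj_seq dW (a *: x + y) ++ dproj_seq dW x ++ dproj_seq dW y).
have su z : {subset dproj_seq dW z <= dproj_seq dW (a *: x + y) ++ dproj_seq dW x ++ dproj_seq dW y} ->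
    dlift z = \sum_(j <- u) h j (dproj dW j z).
  by move=> s; apply: dliftE (undup_uniq _) _ => j /s; rewrite mem_undup.
rewrite !su; do ?by move=> j; rewrite !mem_cat => ->; rewrite ?orbT.
apply: (lin_bigsum u (fun j => lin_comp (hl j) (dproj_linear cW dW j))).
Qed.

Lemma dlift_id j x : x \in W j -> dlift x = h j x.
Proof.
move=> Wx; rewrite (@dliftE (undup (j :: dproj_seq dW x))) ?undup_uniq //; last first.
  by move=> i ix; rewrite mem_undup inE ix orbT.
rewrite (bigD1_seq j) ?undup_uniq ?mem_undup ?mem_head //= (dproj_id cW) //.
rewrite big1 ?addr0 // => i ij; rewrite (dproj_0 cW dW Wx) ?lin0 //.
by rewrite eq_sym.
Qed.
End DirectLift.

(** * Graded linear maps and graded isomorphisms *)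

Section GradedAlgebra.
Variables (F : fieldType) (G : groupType).
Implicit Types (A B : graded_algebra F G).

Definition graded_linear A B (f : A -> B) : Prop :=
  linear f /\ forall g x, x \in gr_comp A g -> f x \in gr_comp B g.

Lemma graded_linear_dproj A B (f : A -> B) g x : graded_linear f ->
  dproj (gr_direct B) g (f x) = f (dproj (gr_direct A) g x).
Proof.
move=> [lf gf]; move: x; apply: (direct_sum_ext (gr_direct A)).
- by apply: lin_comp => //; apply: dproj_linear; apply: gr_comp_closed.
- by apply: lin_comp => //; apply: dproj_linear; apply: gr_comp_closed.
move=> h x Ax; have [hg|hg] := eqVneq h g.
  by rewrite -hg !dproj_id ?gf //; apply: gr_comp_closed.
have cA := gr_comp_closed A; have cB := gr_comp_closed B.
by rewrite (dproj_0 cA _ Ax hg) (dproj_0 cB _ (gf _ _ Ax) hg) lin0.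
Qed.

(** Both sides are bilinear and the homogeneous elements span [A]. *)
Lemma graded_mulP A (C : algebra F) (f : A -> C) : linear f ->
  (forall g h x y, x \in gr_comp A g -> y \in gr_comp A h -> f (x * y) = f x * f y) ->
  {morph f : x y / x * y}.
Proof.
move=> lf fM x y; move: x.
apply: (direct_sum_ext (gr_direct A)) => [||g x Ax].
- exact: lin_comp lf (algMlinl y).
- exact: lin_comp (algMlinl (f y)) lf.
move: y; apply: (direct_sum_ext (gr_direct A)) => [||h y Ay].
- exact: lin_comp lf (algMlinr x).
- exact: lin_comp (algMlinr (f x)) lf.
exact: fM Ax Ay.
Qed.

Lemma graded_iso_refl A : graded_iso A A.
Proof. by exists id; split=> //; exists id. Qed.

(** The inverse of a graded isomorphism is graded because the isomorphism commutes
    with the projections onto components: if [f x] equals its own [g]-component,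
    which is the image of that of [x], then so does [x] by injectivity. *)
Lemma graded_isoP A B : graded_iso A B <-> exists (f : A -> B) (f' : B -> A),
  [/\ graded_linear f, graded_linear f', cancel f f', cancel f' f &
      GRing.monoid_morphism f].
Proof.
split; last first.
  case=> f [f' [[lf gf] _ fK f'K mf]]; exists f; split=> //.
  by exists f'.
case=> f [[f' fK f'K] lf mf gf]; have lf' := lin_inv lf fK f'K.
exists f, f'; split=> //; split=> // g y By.
suff -> : f' y = dproj (gr_direct A) g (f' y).
  exact: dproj_in (gr_comp_closed A) _ _ _.
apply: (can_inj fK); rewrite f'K -graded_linear_dproj //.
by rewrite f'K dproj_id //; apply: gr_comp_closed.
Qed.

Lemma graded_iso_sym A B : graded_iso A B -> graded_iso B A.
Proof.
move=> /graded_isoP[f [f' [gf gf' fK f'K [f1 fM]]]]; apply/graded_isoP.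
exists f', f; split=> //.
by split=> [|x y]; rewrite -?f1 ?fK // -{1}[x]f'K -{1}[y]f'K -fM fK.
Qed.

Lemma graded_iso_trans A B C : graded_iso A B -> graded_iso B C -> graded_iso A C.
Proof.
case=> f [bf lf [f1 fM] gf] [g [bg lg [g1 gM] gg]]; exists (g \o f); split.
- exact: bij_comp.
- exact: lin_comp.
- by split=> [|x y] /=; rewrite ?f1 // fM gM.
by move=> h x /gf/gg.
Qed.

(** Classes are predicates, so the equality of two classes amounts, by
    extensionality, to an isomorphism of representatives. *)
Lemma graded_iso_class A B : graded_iso A B <-> graded_iso A = graded_iso B.
Proof.
split=> [AB|->]; last exact: graded_iso_refl.
apply/funext => C; apply/propext; split; apply: graded_iso_trans => //.
exact: graded_iso_sym.
Qed.
End GradedAlgebra.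

(** * Generators and universal property of the graded product *)

Section Gpair.
Variables (F : fieldType) (G : groupType) (A B : graded_algebra F G).
Local Notation P := (graded_product A B).
Local Notation valP_ := (subalg_val (SP := graded_tensor_closed A B)).
Local Notation pA := (dproj (gr_direct A)).
Local Notation pB := (dproj (gr_direct B)).

Let vlin : linear valP_ := subalg_val_linear (SP := graded_tensor_closed A B).

Lemma gpure_in g (a : A) (b : B) : tpure (pA g a) (pB g b) \in @graded_tensor F G A B.
Proof.
apply: tensor_comp_sub; apply: tensor_comp_pure; exact: dproj_in (gr_comp_closed _) _ _ _.
Qed.

(** Projecting both factors to degree [g] makes the tensor lie in the graded
    product for arbitrary [a] and [b], so that bilinearity can be stated. *)
Definition gpure g (a : A) (b : B) : P := exist _ (tpure (pA g a) (pB g b)) (gpure_in g a b).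

Lemma gpure_linl g b : linear (gpure g ^~ b).
Proof. by move=> c x y; apply: val_inj; rewrite [RHS]vlin; apply: tensor_projl. Qed.

Lemma gpure_linr g a : linear (gpure g a).
Proof. by move=> c x y; apply: val_inj; rewrite [RHS]vlin; apply: tensor_projr. Qed.

(** The sum of all [gpure g a b], which has finitely many nonzero terms. *)
Definition gpair (a : A) (b : B) : P := dlift (gr_direct A) (fun g => gpure g ^~ b) a.

Lemma gpair_linl b : linear (gpair^~ b).
Proof.
apply: dlift_linear (gr_comp_closed A) _ _ _ => g; exact: gpure_linl.
Qed.

Lemma gpair_linr a : linear (gpair a).
Proof. by apply: lin_bigsum => g; apply: gpure_linr. Qed.

Lemma gpair_val g a b : a \in gr_comp A g -> b \in gr_comp B g ->
  valP_ (gpair a b) = tpure a b.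
Proof.
move=> Aa Bb; rewrite /gpair (dlift_id (gr_comp_closed A) _ _ Aa) /=; last first.
  by move=> h; apply: gpure_linl.
by rewrite /subalg_val /= !dproj_id //; apply: gr_comp_closed.
Qed.

Lemma gpair_comp g a b : a \in gr_comp A g -> b \in gr_comp B g ->
  gpair a b \in gr_comp P g.
Proof.
move=> Aa Bb; change (valP_ (gpair a b) \in @tensor_comp F G A B g).
by rewrite (gpair_val Aa Bb) tensor_comp_pure.
Qed.

Lemma gpair1 : gpair 1 1 = 1 :> P.
Proof. by apply: val_inj; apply: gpair_val; apply: gr_comp1. Qed.

Lemma gpairM g h a b a' b' :
  a \in gr_comp A g -> b \in gr_comp B g -> a' \in gr_comp A h -> b' \in gr_comp B h ->
  gpair a b * gpair a' b' = gpair (a * a') (b * b') :> P.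
Proof.
move=> Aa Bb Aa' Bb'; apply: val_inj.
transitivity (valP_ (gpair (a * a') (b * b'))); last by [].
rewrite (gpair_val (gr_compM A g h _ _ Aa Aa') (gr_compM B g h _ _ Bb Bb')).
rewrite -tensor_mulE -(gpair_val Aa Bb) -(gpair_val Aa' Bb').
by [].
Qed.

(** The [g]-component is defined as a span inside the full tensor product,
    whereas [Q] lives on the subalgebra; the induction runs over the tensors that
    come from an element of [Q]. *)
Lemma gprod_comp_ind g (Q : {pred P}) : submod_closed Q ->
  (forall a b, a \in gr_comp A g -> b \in gr_comp B g -> gpair a b \in Q) ->
  {subset gr_comp P g <= Q}.
Proof.
move=> [Q0 cQ] QP x; change (valP_ x \in @tensor_comp F G A B g -> x \in Q) => Tx.
pose R : {pred tensor_alg A B} := [pred t | `[< exists y : P, valP_ y = t /\ y \in Q >]].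
suff /asboolP[y [/val_inj <-]] : valP_ x \in R by [].
apply: (span_sub (P := R) _ _ Tx) => [|_ [a [b [Aa Bb ->]]]].
  split=> [|c u v].
    by apply/asboolP; exists 0; split=> //; apply: lin0 vlin.
  move=> /asboolP[y [<- Qy]] /asboolP[z [<- Qz]]; apply/asboolP.
  by exists (c *: y + z); split; [apply: vlin|apply: cQ].
by apply/asboolP; exists (gpair a b); rewrite (gpair_val Aa Bb); split=> //; apply: QP.
Qed.

Lemma gprod_comp_ext (W : lmodType F) (u v : P -> W) g : linear u -> linear v ->
  (forall a b, a \in gr_comp A g -> b \in gr_comp B g -> u (gpair a b) = v (gpair a b)) ->
  {in gr_comp P g, u =1 v}.
Proof.
move=> lu lv e x Px; apply/eqP.
by apply: (gprod_comp_ind (lin_ker_closed lu lv) _ Px) => a b Aa Bb; apply/eqP/e.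
Qed.

Lemma gprod_ext (W : lmodType F) (u v : P -> W) : linear u -> linear v ->
  (forall g a b, a \in gr_comp A g -> b \in gr_comp B g -> u (gpair a b) = v (gpair a b)) ->
  u =1 v.
Proof.
move=> lu lv e; apply: (direct_sum_ext (gr_direct P)) => // g.
by move=> x; apply: gprod_comp_ext => // a b; apply: e.
Qed.

Lemma gprod_graded (C : graded_algebra F G) (u : P -> C) : linear u ->
  (forall g a b, a \in gr_comp A g -> b \in gr_comp B g -> u (gpair a b) \in gr_comp C g) ->
  graded_linear u.
Proof.
move=> lu uP; split=> // g; apply: gprod_comp_ind (uP g).
exact: lin_preim_closed lu (gr_comp_closed C g).
Qed.

Lemma gprod_morph (C : algebra F) (u : P -> C) : linear u ->
  (forall g h a b a' b', a \in gr_comp A g -> b \in gr_comp B g ->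
    a' \in gr_comp A h -> b' \in gr_comp B h ->
    u (gpair (a * a') (b * b')) = u (gpair a b) * u (gpair a' b')) ->
  {morph u : x y / x * y}.
Proof.
move=> lu uM; apply: graded_mulP => // g h x y Px Py; move: x Px.
apply: gprod_comp_ext => [||a b Aa Bb].
- exact: lin_comp lu (algMlinl y).
- exact: lin_comp (algMlinl (u y)) lu.
move: y Py; apply: gprod_comp_ext => [||a' b' Aa' Bb'].
- exact: lin_comp lu (algMlinr _).
- exact: lin_comp (algMlinr _) lu.
by rewrite (gpairM Aa Bb Aa' Bb'); apply: (uM g h).
Qed.

Variable W : lmodType F.

(** The graded product is a subspace of the tensor product, and the induced map
    is the restriction of the one on the tensor product. *)
Definition gprod_lift (f : A -> B -> W) (x : P) : W := tlift f (valP_ x).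

Variable f : A -> B -> W.
Hypotheses (fl : forall b, linear (f^~ b)) (fr : forall a, linear (f a)).

Lemma gprod_lift_linear : linear (gprod_lift f).
Proof. exact: lin_comp (tlift_linear fl fr) vlin. Qed.

Lemma gprod_lift_pair g a b : a \in gr_comp A g -> b \in gr_comp B g ->
  gprod_lift f (gpair a b) = f a b.
Proof. by move=> Aa Bb; rewrite /gprod_lift (gpair_val Aa Bb) tlift_pure. Qed.
End Gpair.

(** * Isomorphisms between graded products *)

Lemma tlift_param_linear (F : fieldType) (U V W X : lmodType F)
  (f : X -> U -> V -> W) t :
  (forall x v, linear ((f x)^~ v)) -> (forall x u, linear (f x u)) ->
  (forall u v, linear (fun x => f x u v)) -> linear (fun x => tlift (f x) t).
Proof.
move=> fl fr fx; have [s ->] := tensor_sum t.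
have e x : tlift (f x) (\sum_(p <- s) tpure p.1 p.2) = \sum_(p <- s) f x p.1 p.2.
  rewrite lin_sum; last exact: tlift_linear (fl x) (fr x).
  by apply: eq_bigr => p _; apply: tlift_pure.
by move=> a x y; rewrite !e; apply: (lin_bigsum s (fun p => fx p.1 p.2)).
Qed.

Section Isomorphisms.
Variables (F : fieldType) (G : groupType).
Implicit Types (A B C : graded_algebra F G).

(** It suffices to test a candidate isomorphism on generators, except for the
    identity [u (v y) = y], where [C] need not be a graded product. *)
Lemma gprod_iso A B C (u : graded_product A B -> C) (v : C -> graded_product A B) :
  linear u -> linear v -> cancel v u -> u 1 = 1 ->
  (forall g a b, a \in gr_comp A g -> b \in gr_comp B g ->
    u (gpair a b) \in gr_comp C g /\ v (u (gpair a b)) = gpair a b) ->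
  (forall g h a b a' b', a \in gr_comp A g -> b \in gr_comp B g ->
    a' \in gr_comp A h -> b' \in gr_comp B h ->
    u (gpair (a * a') (b * b')) = u (gpair a b) * u (gpair a' b')) ->
  graded_iso (graded_product A B) C.
Proof.
move=> lu lv vK u1 uP uM; have uK : cancel u v.
  apply: gprod_ext => [||g a b Aa Bb]; [exact: lin_comp lv lu|by []|].
  by case: (uP g a b Aa Bb).
exists u; split=> //; first by exists v.
  by split=> //; apply: gprod_morph.
apply: (gprod_graded lu _).2 => g a b Aa Bb; by case: (uP g a b Aa Bb).
Qed.

Section Map.
Variables (A B A' B' : graded_algebra F G) (f : A -> A') (g : B -> B').
Hypotheses (gf : graded_linear f) (gg : graded_linear g).

Definition gprod_map : graded_product A B -> graded_product A' B' :=
  gprod_lift (fun a b => gpair (f a) (g b)).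

Lemma gprod_map_linear : linear gprod_map.
Proof.
apply: gprod_lift_linear => [b|a].
- exact: lin_comp (gpair_linl _) gf.1.
- exact: lin_comp (gpair_linr _) gg.1.
Qed.

Lemma gprod_map_pair i a b : a \in gr_comp A i -> b \in gr_comp B i ->
  gprod_map (gpair a b) = gpair (f a) (g b).
Proof.
apply: gprod_lift_pair => [c|c].
- exact: lin_comp (gpair_linl _) gf.1.
- exact: lin_comp (gpair_linr _) gg.1.
Qed.
End Map.

Lemma gprod_map_iso A B A' B' : graded_iso A A' -> graded_iso B B' ->
  graded_iso (graded_product A B) (graded_product A' B').
Proof.
move=> /graded_isoP[f [f' [gf gf' fK f'K [f1 fM]]]].
move=> /graded_isoP[h [h' [gh gh' hK h'K [h1 hM]]]].
have lu := gprod_map_linear gf gh; have lv := gprod_map_linear gf' gh'.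
apply: (gprod_iso lu lv).
- apply: gprod_ext => [||g a b Aa Bb]; [exact: lin_comp lu lv|by []|].
  rewrite (gprod_map_pair gf' gh' Aa Bb).
  by rewrite (gprod_map_pair gf gh (gf'.2 _ _ Aa) (gh'.2 _ _ Bb)) f'K h'K.
- by rewrite -gpair1 (gprod_map_pair gf gh (gr_comp1 A) (gr_comp1 B)) f1 h1 gpair1.
- move=> g a b Aa Bb; have Afa := gf.2 _ _ Aa; have Bhb := gh.2 _ _ Bb.
  rewrite (gprod_map_pair gf gh Aa Bb) (gprod_map_pair gf' gh' Afa Bhb) fK hK.
  by split=> //; apply: gpair_comp.
move=> g k a b a' b' Aa Bb Aa' Bb'.
have Aaa := gr_compM A _ _ _ _ Aa Aa'; have Bbb := gr_compM B _ _ _ _ Bb Bb'.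
rewrite !(gprod_map_pair gf gh Aaa Bbb, gprod_map_pair gf gh Aa Bb,
  gprod_map_pair gf gh Aa' Bb') fM hM.
by rewrite (gpairM (gf.2 _ _ Aa) (gh.2 _ _ Bb) (gf.2 _ _ Aa') (gh.2 _ _ Bb')).
Qed.

Definition gprod_swap A B : graded_product A B -> graded_product B A :=
  gprod_lift (fun a b => gpair b a).

Lemma gprod_swap_linear A B : linear (@gprod_swap A B).
Proof. by apply: gprod_lift_linear => ?; [apply: gpair_linr|apply: gpair_linl]. Qed.

Lemma gprod_swap_pair A B g a b : a \in gr_comp A g -> b \in gr_comp B g ->
  gprod_swap (gpair a b) = gpair b a.
Proof. by apply: gprod_lift_pair => ?; [apply: gpair_linr|apply: gpair_linl]. Qed.

Lemma gprod_swap_graded A B : graded_linear (@gprod_swap A B).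
Proof.
apply: gprod_graded (@gprod_swap_linear A B) _ => g a b Aa Bb.
by rewrite (gprod_swap_pair Aa Bb) gpair_comp.
Qed.

Lemma gprodC_iso A B : graded_iso (graded_product A B) (graded_product B A).
Proof.
have lAB := @gprod_swap_linear A B; have lBA := @gprod_swap_linear B A.
apply: (gprod_iso lAB lBA).
- apply: gprod_ext => [||g b a Bb Aa]; [exact: lin_comp lAB lBA|by []|].
  by rewrite (gprod_swap_pair Bb Aa) (gprod_swap_pair Aa Bb).
- by rewrite -gpair1 (gprod_swap_pair (gr_comp1 A) (gr_comp1 B)) gpair1.
- move=> g a b Aa Bb; rewrite (gprod_swap_pair Aa Bb) (gprod_swap_pair Bb Aa).
  by rewrite gpair_comp.
move=> g h a b a' b' Aa Bb Aa' Bb'.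
have Aaa := gr_compM A _ _ _ _ Aa Aa'; have Bbb := gr_compM B _ _ _ _ Bb Bb'.
rewrite (gprod_swap_pair Aaa Bbb) (gprod_swap_pair Aa Bb) (gprod_swap_pair Aa' Bb').
by rewrite (gpairM Bb Aa Bb' Aa').
Qed.

Section Assoc.
Variables A B C : graded_algebra F G.

Let inl (c : C) (b : B) : linear (fun a : A => gpair a (gpair b c)).
Proof. exact: gpair_linl. Qed.
Let inr (c : C) (a : A) : linear (fun b : B => gpair a (gpair b c)).
Proof. exact: lin_comp (gpair_linr a) (gpair_linl c). Qed.

Definition gprod_assoc : graded_product (graded_product A B) C ->
    graded_product A (graded_product B C) :=
  gprod_lift (fun x c => gprod_lift (fun a b => gpair a (gpair b c)) x).

Let outl (c : C) : linear (gprod_lift (fun (a : A) (b : B) => gpair a (gpair b c))).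
Proof. exact: gprod_lift_linear. Qed.
Let outr (x : graded_product A B) :
  linear (fun c : C => gprod_lift (fun (a : A) (b : B) => gpair a (gpair b c)) x).
Proof.
apply: (tlift_param_linear (f := fun (c : C) (a : A) (b : B) => gpair a (gpair b c))) => //.
by move=> a b; apply: lin_comp (gpair_linr a) (gpair_linr b).
Qed.

Lemma gprod_assoc_linear : linear gprod_assoc.
Proof. exact: gprod_lift_linear. Qed.

Lemma gprod_assoc_pair g a b c : a \in gr_comp A g -> b \in gr_comp B g ->
  c \in gr_comp C g -> gprod_assoc (gpair (gpair a b) c) = gpair a (gpair b c).
Proof.
move=> Aa Bb Cc; rewrite /gprod_assoc (gprod_lift_pair outl outr (gpair_comp Aa Bb) Cc).
exact: (gprod_lift_pair (inl c) (inr c) Aa Bb).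
Qed.
End Assoc.

(** The inverse is composed of swaps and of the associativity map itself, for the
    factors in reverse order. *)
Lemma gprodA_iso A B C : graded_iso (graded_product (graded_product A B) C)
  (graded_product A (graded_product B C)).
Proof.
have lu := @gprod_assoc_linear A B C.
have gs (X Y : graded_algebra F G) := @gprod_swap_graded X Y.
have ls (X Y : graded_algebra F G) := @gprod_swap_linear X Y.
have gid (X : graded_algebra F G) : graded_linear (fun x : X => x) by [].
(* a(bc) -> (bc)a -> (cb)a -> c(ba) -> (ba)c -> (ab)c *)
pose v x := gprod_map (@gprod_swap B A) (fun x : C => x) (gprod_swap (gprod_assoc
  (gprod_map (@gprod_swap B C) (fun x : A => x) (@gprod_swap A (graded_product B C) x)))).
have lv : linear v.
  apply: lin_comp (gprod_map_linear (gs _ _) (gid _)) _.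
  apply: lin_comp (ls _ _) _; apply: lin_comp (@gprod_assoc_linear _ _ _) _.
  exact: lin_comp (gprod_map_linear (gs _ _) (gid _)) (ls _ _).
have vP g a b c : a \in gr_comp A g -> b \in gr_comp B g -> c \in gr_comp C g ->
    v (gpair a (gpair b c)) = gpair (gpair a b) c.
  move=> Aa Bb Cc; rewrite /v (gprod_swap_pair Aa (gpair_comp Bb Cc)).
  rewrite (gprod_map_pair (gs _ _) (gid _) (gpair_comp Bb Cc) Aa).
  rewrite (gprod_swap_pair Bb Cc) (gprod_assoc_pair Cc Bb Aa).
  rewrite (gprod_swap_pair Cc (gpair_comp Bb Aa)).
  rewrite (gprod_map_pair (gs _ _) (gid _) (gpair_comp Bb Aa) Cc).
  by rewrite (gprod_swap_pair Bb Aa).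
apply: (gprod_iso lu lv).
- apply: gprod_ext => [||g a y Aa]; [exact: lin_comp lu lv|by []|].
  move: y; apply: gprod_comp_ext => [||b c Bb Cc].
  + exact: lin_comp (lin_comp lu lv) (gpair_linr a).
  + exact: gpair_linr.
  by rewrite (vP g) // (gprod_assoc_pair Aa Bb Cc).
- by rewrite -!gpair1 (gprod_assoc_pair (gr_comp1 A) (gr_comp1 B) (gr_comp1 C)) !gpair1.
- move=> g x c Px Cc; split.
    move: x Px; apply: gprod_comp_ind => [|a b Aa Bb].
      exact: lin_preim_closed (lin_comp lu (gpair_linl c)) (gr_comp_closed _ g).
    suff : gprod_assoc (gpair (gpair a b) c) \in
      gr_comp (graded_product A (graded_product B C)) g by [].
    by rewrite (gprod_assoc_pair Aa Bb Cc); apply: gpair_comp (gpair_comp _ _).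
  move: x Px; apply: gprod_comp_ext => [||a b Aa Bb].
  + exact: lin_comp (lin_comp lv lu) (gpair_linl c).
  + exact: gpair_linl.
  by rewrite (gprod_assoc_pair Aa Bb Cc) (vP g).
move=> g h x c x' c' Px Cc Px' Cc'.
have Ccc := gr_compM C _ _ _ _ Cc Cc'.
move: x Px; apply: gprod_comp_ext => [||a b Aa Bb].
- exact: lin_comp (lin_comp lu (gpair_linl _)) (algMlinl _).
- exact: lin_comp (algMlinl _) (lin_comp lu (gpair_linl _)).
move: x' Px'; apply: gprod_comp_ext => [||a' b' Aa' Bb'].
- exact: lin_comp (lin_comp lu (gpair_linl _)) (algMlinr _).
- exact: lin_comp (algMlinr _) (lin_comp lu (gpair_linl _)).
have Aaa := gr_compM A _ _ _ _ Aa Aa'; have Bbb := gr_compM B _ _ _ _ Bb Bb'.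
rewrite (gpairM Aa Bb Aa' Bb') (gprod_assoc_pair Aaa Bbb Ccc).
rewrite (gprod_assoc_pair Aa Bb Cc) (gprod_assoc_pair Aa' Bb' Cc').
by rewrite (gpairM Aa (gpair_comp Bb Cc) Aa' (gpair_comp Bb' Cc')) (gpairM Bb Cc Bb' Cc').
Qed.

Section Unit.
Variable A : graded_algebra F G.
Local Notation FG := (graded_group_algebra F G).

(** The elements of [G] as a basis of [FG], typed in the graded algebra so that
    its product and components apply. *)
Definition gelt (g : G) : FG := (<< g >> : {malg F[G]}).

Lemma gelt_comp g : gelt g \in gr_comp FG g.
Proof. by apply/asboolP; exists 1; rewrite scale1r. Qed.

Lemma geltM g h : gelt g * gelt h = gelt (g * h)%g.
Proof. exact: galg_mulU. Qed.

Lemma gelt1 : gelt 1%g = 1.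
Proof. by []. Qed.

Definition gprod_unit (a : A) : graded_product A FG :=
  dlift (gr_direct A) (fun g a => gpair a (gelt g)) a.

Lemma gprod_unit_linear : linear gprod_unit.
Proof. by apply: dlift_linear (gr_comp_closed A) _ _ _ => g; apply: gpair_linl. Qed.

Lemma gprod_unit_comp g a : a \in gr_comp A g -> gprod_unit a = gpair a (gelt g).
Proof.
by move=> Aa; apply: (dlift_id (gr_comp_closed A) _ _ Aa) => h; apply: gpair_linl.
Qed.

(** The element [a (x) m] goes to the sum over [g] of [m_g a_g]; on equal degrees
    this is multiplication by the coefficient of [m]. *)
Definition gprod_counit : graded_product A FG -> A :=
  gprod_lift (fun a (m : FG) => mlift (fun g => dproj (gr_direct A) g a) m).

Let coul (m : FG) : linear (fun a : A => mlift (fun g => dproj (gr_direct A) g a) m).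
Proof.
apply: lin_bigsum => g c x y; rewrite (dproj_linear (gr_comp_closed A)) scalerDr.
by rewrite !scalerA mulrC.
Qed.
Let cour (a : A) : linear (fun m : FG => mlift (fun g => dproj (gr_direct A) g a) m).
Proof. exact: mlift_linear. Qed.

Lemma gprod_counit_linear : linear gprod_counit.
Proof. exact: gprod_lift_linear. Qed.

Lemma gprod_counit_pair g a : a \in gr_comp A g -> gprod_counit (gpair a (gelt g)) = a.
Proof.
move=> Aa; rewrite /gprod_counit (gprod_lift_pair coul cour Aa (gelt_comp g)).
by rewrite mliftU dproj_id //; apply: gr_comp_closed.
Qed.

Lemma gprod_unit_iso : graded_iso A (graded_product A FG).
Proof.
have lu := gprod_unit_linear; have lv := gprod_counit_linear.
exists gprod_unit; split=> //.
- exists gprod_counit.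
    apply: (direct_sum_ext (gr_direct A)) => [||g a Aa]; [exact: lin_comp lv lu|by []|].
    by rewrite (gprod_unit_comp Aa) gprod_counit_pair.
  apply: gprod_ext => [||g a m Aa /asboolP[c ->]]; [exact: lin_comp lu lv|by []|].
  rewrite -[c *: << g >>]/(c *: gelt g) (linZ (gpair_linr a)).
  by rewrite (linZ lv) (linZ lu) gprod_counit_pair // (gprod_unit_comp Aa).
- split; first by rewrite (gprod_unit_comp (gr_comp1 A)) gelt1 gpair1.
  apply: graded_mulP => // g h a b Aa Ab.
  rewrite (gprod_unit_comp Aa) (gprod_unit_comp Ab) (gpairM Aa (gelt_comp g) Ab (gelt_comp h)).
  by rewrite (gprod_unit_comp (gr_compM A _ _ _ _ Aa Ab)) geltM.
by move=> g a Aa; rewrite (gprod_unit_comp Aa) gpair_comp ?gelt_comp.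
Qed.
End Unit.
End Isomorphisms.

(** * The monoid of graded classes *)

Section Classes.
Variables (F : fieldType) (G : groupType) (K : Type).
Hypothesis natK : embeds nat K.

(** A finite sum of pure tensors is determined by the sequence of its terms. *)
Lemma card_bounded_product (A B : graded_algebra F G) :
  card_bounded K A -> card_bounded K B -> card_bounded K (graded_product A B).
Proof.
move=> /card_leTT kA /card_leTT kB; apply/card_leTT.
have kAB : embeds (A * B) K := embeds_trans (embeds_prod kA kB) (embeds_square natK).
apply: embeds_trans (embeds_seq_of natK kAB).
have [f fP] := choice (fun x : graded_product A B => tensor_sum (val x : tensor A B)).
by exists f => x y e; apply: val_inj; rewrite fP e -fP.
Qed.

(** An element of [FG] is determined by the sequence of its nonzero coefficients
    with their indices. *)
Lemma card_bounded_group_algebra : embeds F K -> embeds G K ->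
  card_bounded K (graded_group_algebra F G).
Proof.
move=> kF kG; apply/card_leTT.
have kGF : embeds (G * F) K := embeds_trans (embeds_prod kG kF) (embeds_square natK).
apply: embeds_trans (embeds_seq_of natK kGF).
exists (fun m : {malg F[G]} => [seq (g, m@_g) | g <- msupp m]).
pose d (s : seq (G * F)) : {malg F[G]} := \sum_(p <- s) p.2 *: << p.1 >>.
by apply: (can_inj (g := d)) => m; rewrite /d big_map -malg_lin.
Qed.

Lemma GrP (X : Gr F G K) :
  exists (A : graded_algebra F G) (kA : card_bounded K A), X = gr_class kA.
Proof.
by case: X => C [A [kA eC]]; exists A, kA; apply: eq_exist.
Qed.

Lemma gr_class_eq (A B : graded_algebra F G) (kA : card_bounded K A)
    (kB : card_bounded K B) :
  gr_class kA = gr_class kB <-> graded_iso A B.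
Proof.
rewrite graded_iso_class; split=> [/(congr1 sval)//|e].
exact: eq_exist.
Qed.

(** The operation is computed on chosen representatives; isomorphic
    representatives have isomorphic products. *)
Lemma graded_product_rule_ex : exists op, @graded_product_rule F G K op.
Proof.
have [r rP] := choice (@GrP).
pose kr X : card_bounded K (r X) := projT1 (cid (rP X)).
have krP X : X = gr_class (kr X) := projT2 (cid (rP X)).
exists (fun X Y => gr_class (card_bounded_product (kr X) (kr Y))) => A B kA kB.
exists (card_bounded_product kA kB); apply/gr_class_eq.
by apply: gprod_map_iso; apply: graded_iso_sym; apply/gr_class_eq/krP.
Qed.

Lemma graded_product_rule_unique op op' : @graded_product_rule F G K op ->
  @graded_product_rule F G K op' -> op = op'.
Proof.
move=> opP opP'; apply/funext => X; apply/funext => Y.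
have [A [kA ->]] := GrP X; have [B [kB ->]] := GrP Y.
have [kAB ->] := opP A B kA kB; have [kAB' ->] := opP' A B kA kB.
exact/gr_class_eq/graded_iso_refl.
Qed.
End Classes.

Theorem theorem4p2 (F : fieldType) (G : groupType) (K : Type)
    (infK : infinite_set [set: K]%classic)
    (leFK : ([set: F] #<= [set: K])%card) (leGK : ([set: G] #<= [set: K])%card) :
  exists op : Gr F G K -> Gr F G K -> Gr F G K,
    unique (@graded_product_rule F G K) op /\
    exists kFG : card_bounded K (graded_group_algebra F G),
      [/\ associative op, commutative op,
          left_id (gr_class kFG) op & right_id (gr_class kFG) op].
Proof.
have natK : embeds nat K by apply/card_leTT/infiniteP.
have [op opP] := graded_product_rule_ex F G natK.
have kFG := card_bounded_group_algebra natK ((card_leTT _ _).1 leFK)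
  ((card_leTT _ _).1 leGK).
have opC : commutative op.
  move=> X Y; have [A [kA ->]] := GrP X; have [B [kB ->]] := GrP Y.
  have [kAB ->] := opP A B kA kB; have [kBA ->] := opP B A kB kA.
  exact/gr_class_eq/gprodC_iso.
have op1 : right_id (gr_class kFG) op.
  move=> X; have [A [kA ->]] := GrP X.
  have [kP ->] := opP _ _ kA kFG.
  exact/gr_class_eq/graded_iso_sym/gprod_unit_iso.
exists op; split; first by split=> // op'; apply: graded_product_rule_unique.
exists kFG; split=> //; last by move=> X; rewrite opC.
move=> X Y Z; have [A [kA ->]] := GrP X; have [B [kB ->]] := GrP Y.
have [C [kC ->]] := GrP Z.
have [kAB ->] := opP _ _ kA kB; have [kBC ->] := opP _ _ kB kC.
have [kL ->] := opP _ _ kA kBC; have [kR ->] := opP _ _ kAB kC.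
exact/gr_class_eq/graded_iso_sym/gprodA_iso.
Qed.
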